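(* For all graphs $G$ and $H$, $$\gamma_{gr}^{t}(G\boxtimes H)\ \ge\ \max\{\,\gamma_{gr}^{t}(G)\,a(D)+(|\widehat{D}|-a(D))\,\gamma_{gr}(G)\ :\ D\text{ is a dominating sequence of }H\,\}.$$
   Context: Graphs are finite, simple and undirected, with nonempty vertex set. $N(v)$ and $N[v]=N(v)\cup\{v\}$ denote open and closed neighborhoods. A legal open neighborhood sequence of a graph is a sequence $(v_1,\ldots,v_k)$ of distinct vertices with $N(v_i)\setminus\bigcup_{j=1}^{i-1}N(v_j)\neq\emptyset$ for each $i$; its maximum length is the Grundy total domination number $\gamma_{gr}^{t}$ ($0$ if there are no edges). A dominating sequence (legal closed neighborhood sequence) is a sequence $(d_1,\ldots,d_k)$ of distinct vertices with $N[d_i]\setminus\bigcup_{j=1}^{i-1}N[d_j]\neq\emptyset$ for each $i$; its maximum length is the Grundy domination number $\gamma_{gr}$. For a dominating sequence $D=(d_1,\ldots,d_k)$, $\widehat{D}=\{d_1,\ldots,d_k\}$ and $a(D)$ is the number of vertices $d_i$ of $D$ that are not adjacent to any vertex from $\{d_1,\ldots,d_{i-1}\}$. The strong product $G\boxtimes H$ has vertex set $V(G)\times V(H)$, and $(g_1,h_1)$, $(g_2,h_2)$ are adjacent iff $g_1g_2\in E(G)$ and $h_1=h_2$, or $g_1=g_2$ and $h_1h_2\in E(H)$, or $g_1g_2\in E(G)$ and $h_1h_2\in E(H)$. *)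

(* Defs.v *)
From HB Require Import structures.
From mathcomp Require Import all_boot.

Set Implicit Arguments.
Unset Strict Implicit.
Unset Printing Implicit Defensive.

(* Finite simple undirected graphs on a nonempty vertex set. *)
Record sgraph := SGraph {
  vertex :> finType;
  edge : rel vertex;
  edge_sym : symmetric edge;
  edge_irrefl : irreflexive edge;
  vertex_gt0 : 0 < #|vertex|
}.

Definition open_nbhd (G : sgraph) (v : G) : {set G} := [set u | edge v u].

Definition closed_nbhd (G : sgraph) (v : G) : {set G} := v |: open_nbhd v.

Definition legal_seq (T : finType) (nbhd : T -> {set T}) (s : seq T) : bool :=
  uniq s &&
  [forall i : 'I_(size s),
     nbhd (tnth (in_tuple s) i)
       :\: \bigcup_(j < size s | j < i) nbhd (tnth (in_tuple s) j) != set0].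

Definition legal_open_seq (G : sgraph) (s : seq G) : bool :=
  legal_seq (@open_nbhd G) s.

Definition dominating_seq (G : sgraph) (s : seq G) : bool :=
  legal_seq (@closed_nbhd G) s.

(* Sequences of distinct vertices have length at most #|G|, so the bounded
   sequences {bseq #|G| of G} include every legal sequence. *)
Definition grundy_total_dom (G : sgraph) : nat :=
  \max_(s : {bseq #|G| of G} | legal_open_seq s) size s.

Definition grundy_dom (G : sgraph) : nat :=
  \max_(s : {bseq #|G| of G} | dominating_seq s) size s.

(* a(D), counted by positions; the entries of a dominating sequence are
   distinct, so this is the number of such vertices. *)
Definition num_nonadj_earlier (G : sgraph) (D : seq G) : nat :=
  #|[set i : 'I_(size D) |
      [forall j : 'I_(size D),
         (j < i) ==> ~~ edge (tnth (in_tuple D) i) (tnth (in_tuple D) j)]]|.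

Section StrongProduct.
Variables G H : sgraph.

Definition strong_edge : rel (G * H) := fun x y =>
  [|| edge x.1 y.1 && (x.2 == y.2),
      (x.1 == y.1) && edge x.2 y.2
    | edge x.1 y.1 && edge x.2 y.2].

Lemma strong_edge_sym : symmetric strong_edge.
Proof.
move=> x y; rewrite /strong_edge (edge_sym x.1) (edge_sym x.2).
by rewrite (eq_sym x.1) (eq_sym x.2).
Qed.

Lemma strong_edge_irrefl : irreflexive strong_edge.
Proof. by move=> x; rewrite /strong_edge !edge_irrefl andbF. Qed.

Lemma strong_vertex_gt0 : 0 < #|{: G * H}|.
Proof. by rewrite card_prod muln_gt0 !vertex_gt0. Qed.

Definition strong_product : sgraph :=
  SGraph strong_edge_sym strong_edge_irrefl strong_vertex_gt0.

End StrongProduct.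

(* For a dominating sequence D, a(D) <= #|D|, so that the truncated
   subtraction in #|D| - a(D) is the usual one. *)
Lemma num_nonadj_earlier_le (G : sgraph) (D : seq G) :
  dominating_seq D -> num_nonadj_earlier D <= #|[set d in D]|.
Proof.
case/andP=> uD _; rewrite cardsE (card_uniqP uD) -[X in _ <= X]card_ord.
exact: max_card.
Qed.

(* Main.v *)
Require Import Defs.
From HB Require Import structures.
From mathcomp Require Import all_boot.

(** Run through a dominating sequence [D] of [H].  For each [d] of [D] append a
    copy of a longest legal open sequence of [G] in the fibre of [d] when [d]
    has no earlier neighbour, and a copy of a longest dominating sequence of [G]
    otherwise.  In the first case [d] itself is undominated so far, and inside
    the fibre of [d] adjacency is that of [G].  In the second case [d] newly
    dominates some [h <> d], and a vertex of the fibre of [d] is adjacent to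
    exactly the closed neighbourhood of its [G]-coordinate in the fibre of
    [h]. *)

Lemma forall_ord_take {T : Type} (p : pred T) (s : seq T) (i : nat) :
  i <= size s ->
  [forall j : 'I_(size s), (j < i) ==> p (tnth (in_tuple s) j)]
    = all p (take i s).
Proof.
move=> le_is; apply/forallP/idP => [pP|].
  case: s => [|x0 s'] // in le_is pP *.
  apply/(all_nthP x0) => k; rewrite size_takel // => lt_ki.
  rewrite nth_take //.
  have:= pP (Ordinal (leq_trans lt_ki le_is)).
  by rewrite (tnth_nth x0) /= lt_ki.
move=> pP j; apply/implyP=> lt_ji.
have x0 := tnth (in_tuple s) j.
move/(all_nthP x0)/(_ j): pP.
by rewrite size_takel // nth_take // (tnth_nth x0); apply.
Qed.

(** The condition that legality puts on [x] when it follows [s], phrased over a list so that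
    sequences can be built from the right. *)
Definition footprints {T : finType} (nbhd : T -> {set T}) (s : seq T) (x : T) :=
  [exists u in nbhd x, all (fun y => u \notin nbhd y) s].

Lemma footprintsP {T : finType} (nbhd : T -> {set T}) (s : seq T) (x : T) :
  reflect (exists2 u, u \in nbhd x & {in s, forall y, u \notin nbhd y})
          (footprints nbhd s x).
Proof.
apply: (iffP exists_inP) => -[u xu su]; exists u => //; exact/allP.
Qed.

Lemma legal_seqE {T : finType} (nbhd : T -> {set T}) (x0 : T) (s : seq T) :
  legal_seq nbhd s =
    uniq s && all (fun i => footprints nbhd (take i s) (nth x0 s i))
                  (iota 0 (size s)).
Proof.
rewrite /legal_seq; congr andb.
have E (i : 'I_(size s)) :
    (nbhd (tnth (in_tuple s) i)
       :\: \bigcup_(j < size s | j < i) nbhd (tnth (in_tuple s) j) != set0)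
    = footprints nbhd (take i s) (nth x0 s i).
  rewrite -(tnth_nth x0 (in_tuple s)).
  apply/set0Pn/exists_inP => [[u]|[u xu su]].
    rewrite inE => /andP[/bigcupP nsu xu]; exists u => //.
    rewrite -forall_ord_take 1?ltnW //.
    apply/forallP=> j; apply/implyP=> lt_ji; apply/negP=> ju.
    by apply: nsu; exists j.
  exists u; rewrite inE xu andbT; apply/bigcupP=> -[j lt_ji ju].
  move: su; rewrite -forall_ord_take 1?ltnW // => /forallP/(_ j).
  by rewrite lt_ji ju.
apply/forallP/allP => [lP i|lP i]; last by rewrite E lP // mem_iota /=.
rewrite mem_iota /= => lt_i.
by rewrite -(E (Ordinal lt_i)).
Qed.

Lemma legal_seq_nil {T : finType} (nbhd : T -> {set T}) : legal_seq nbhd [::].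
Proof. by apply/andP; split=> //; apply/forallP=> -[]. Qed.

Lemma legal_seq_rcons {T : finType} (nbhd : T -> {set T}) (s : seq T) (x : T) :
  legal_seq nbhd (rcons s x) = legal_seq nbhd s && footprints nbhd s x.
Proof.
rewrite !(legal_seqE _ x) rcons_uniq size_rcons -addn1 iotaD all_cat /= andbT.
rewrite add0n nth_rcons ltnn eqxx -cats1 take_size_cat //.
have -> : all (fun i => footprints nbhd (take i (s ++ [:: x]))
                                   (nth x (s ++ [:: x]) i)) (iota 0 (size s))
        = all (fun i => footprints nbhd (take i s) (nth x s i))
              (iota 0 (size s)).
  apply: eq_in_all => i; rewrite mem_iota /= => lt_i.
  by rewrite nth_cat lt_i takel_cat // ltnW.
case: footprintsP => [[u xu su]|_]; last by rewrite !andbF.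
(* Distinctness comes for free: the witness [u] lies in [nbhd x] but in the neighbourhood of no
   member of [s]. *)
have -> // : x \notin s by apply/negP=> /su; rewrite xu.
by rewrite !andbT.
Qed.

(* [w u] is a witness in [U] for the footprint [u] in [T]. *)
Lemma legal_seq_cat_map {T U : finType} (nT : T -> {set T}) (nU : U -> {set U})
    (f w : T -> U) (S : seq U) (s : seq T) :
    (forall x u, (w u \in nU (f x)) = (u \in nT x)) ->
    (forall u, {in S, forall y, w u \notin nU y}) ->
  legal_seq nU S -> legal_seq nT s -> legal_seq nU (S ++ map f s).
Proof.
move=> wf wS lS; elim/last_ind: s => [|s x IHs]; first by rewrite cats0.
rewrite legal_seq_rcons map_rcons -rcons_cat legal_seq_rcons.
case/andP=> /IHs -> /footprintsP[u xu su]; apply/footprintsP.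
exists (w u) => [|y]; first by rewrite wf.
rewrite mem_cat => /orP[/wS-> // | /mapP[z sz ->]].
by rewrite wf su.
Qed.

(** Distinct entries keep the length within [#|T|], so [s] is among the bounded sequences of the
    maximum. *)
Lemma size_legal_seq_le {T : finType} (nbhd : T -> {set T}) (s : seq T) :
  legal_seq nbhd s ->
  size s <= \max_(s : {bseq #|T| of T} | legal_seq nbhd s) size s.
Proof.
move=> ls; have /andP[/card_uniqP eq_s _] := ls.
have le_s : size s <= #|T| by rewrite -eq_s max_card.
by rewrite (@leq_bigmax_cond _ _ (fun s => size (bseqval s)) (Bseq le_s)).
Qed.

(** The maximum is attained because the empty sequence is legal. *)
Lemma max_legal_seqP {T : finType} (nbhd : T -> {set T}) :
  exists2 s, legal_seq nbhd s
    & size s = \max_(s : {bseq #|T| of T} | legal_seq nbhd s) size s.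
Proof.
pose P := [pred s : {bseq #|T| of T} | legal_seq nbhd s].
have P_gt0 : 0 < #|P|.
  by apply/card_gt0P; exists (nil_bseq #|T| T); apply: legal_seq_nil.
have [s Ps Es] := eq_bigmax_cond (fun s : {bseq #|T| of T} => size s) P_gt0.
by exists s.
Qed.

Lemma num_nonadj_earlierE {G : sgraph} (x0 : G) (D : seq G) :
  num_nonadj_earlier D =
    \sum_(i < size D) all (fun y => ~~ edge (nth x0 D i) y) (take i D).
Proof.
rewrite /num_nonadj_earlier -sum1_card big_mkcond /=.
apply: eq_bigr => i _; rewrite inE -forall_ord_take 1?ltnW //.
by rewrite (tnth_nth x0); case: ifP.
Qed.

Lemma num_nonadj_earlier_rcons {G : sgraph} (D : seq G) (x : G) :
  num_nonadj_earlier (rcons D x) =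
    num_nonadj_earlier D + all (fun y => ~~ edge x y) D.
Proof.
rewrite !(num_nonadj_earlierE x) size_rcons big_ord_recr /=.
rewrite nth_rcons ltnn eqxx -cats1 take_size_cat //; congr addn.
apply: eq_bigr => i _.
by rewrite nth_cat ltn_ord takel_cat // ltnW.
Qed.

Lemma card_dominating_seq {G : sgraph} (D : seq G) :
  dominating_seq D -> #|[set d in D]| = size D.
Proof. by case/andP=> /card_uniqP uD _; rewrite cardsE uD. Qed.

(** Closed neighbourhoods in a strong product are products of closed neighbourhoods; the open one
    omits [x] itself. *)
Lemma in_open_strong {G H : sgraph} (x y : strong_product G H) :
  (y \in open_nbhd x) =
    [&& y.1 \in closed_nbhd x.1, y.2 \in closed_nbhd x.2 & y != x].
Proof.
case: x y => [a b] [c d]; rewrite !inE /edge /= /strong_edge /= xpair_eqE.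
rewrite (eq_sym a) (eq_sym b).
case: (eqVneq c a) => [->|_]; case: (eqVneq d b) => [->|_] //=;
  by rewrite ?edge_irrefl ?andbT ?andbF ?orbF.
Qed.

(** Induction on [D] from the right. Keeping [S] in the fibres of [D] ensures that a vertex of [H]
    not dominated by [D] has its whole fibre free of neighbours of [S]. *)
Lemma legal_open_strong {G H : sgraph} (A B : seq G) (D : seq H) :
    legal_open_seq A -> dominating_seq B -> dominating_seq D ->
  exists S : seq (strong_product G H),
    [/\ legal_open_seq S, {in S, forall x, x.2 \in D}
      & size S = size A * num_nonadj_earlier D
                 + (size D - num_nonadj_earlier D) * size B].
Proof.
move=> lA lB; elim/last_ind: D => [_|D d IHD].
  exists [::]; split=> //; first exact: legal_seq_nil.
  by rewrite /num_nonadj_earlier eq_card0 ?muln0 // => -[].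
rewrite /dominating_seq legal_seq_rcons => /andP[lD fD].
(* Needed for the truncated subtraction when [size D] grows and the count does not. *)
have le_aD := num_nonadj_earlier_le lD; rewrite card_dominating_seq // in le_aD.
have [S [lS SD szS]] := IHD lD.
have fibre (C : seq G) :
    {in S ++ [seq (g, d) | g <- C], forall x, x.2 \in rcons D d}.
  move=> x; rewrite mem_rcons inE mem_cat => /orP[/SD-> | /mapP[g _ ->]] /=.
    by rewrite orbT.
  by rewrite eqxx.
have undominated h : {in D, forall y, h \notin closed_nbhd y} ->
    forall u : G, {in S, forall x : strong_product G H,
      ((u, h) : strong_product G H) \notin open_nbhd x}.
  by move=> Dh u x Sx; rewrite in_open_strong (negPf (Dh _ (SD _ Sx))) andbF.
have [u du Du] := footprintsP _ _ _ fD.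
rewrite num_nonadj_earlier_rcons size_rcons.
case: allP => [nadj | adj].
  exists (S ++ [seq (g, d) | g <- A]); split=> //; last first.
    by rewrite size_cat size_map szS addn1 subSS mulnS addnAC
      (addnC (size A)).
  (* Witnesses are taken in the fibre of [d] itself. *)
  apply: (@legal_seq_cat_map _ _ _ _ _ (pair^~ d)) (lS) lA.
    move=> x v; rewrite in_open_strong !inE /= eqxx xpair_eqE eqxx andbT /=.
    by case: eqVneq => [->|_] /=; rewrite ?edge_irrefl ?andbT.
  apply: undominated => y Dy; rewrite !inE negb_or (edge_sym y) nadj // andbT.
  (* [d] is not in [D], since it dominates [u] and no vertex of [D] does. *)
  by apply/eqP=> dy; move: (Du y Dy); rewrite -dy du.
exists (S ++ [seq (g, d) | g <- B]); split=> //; last first.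
  by rewrite size_cat size_map szS addn0 subSn // mulSn -addnA
    (addnC (size B)).
(* Witnesses are taken in the fibre of the newly dominated [u]. *)
apply: (@legal_seq_cat_map _ _ _ _ _ (pair^~ u)) (lS) lB; last exact: undominated.
move=> x v; rewrite in_open_strong /= du xpair_eqE.
(* Different fibres never share a vertex, so closed neighbourhoods of [G] remain. Were [u = d], then
   [d] would have no neighbour in [D], against [adj]. *)
suff /negPf-> : u != d by rewrite andbF andbT.
apply/eqP=> ud; apply: adj => y Dy; apply: contra (Du y Dy).
by rewrite ud !inE (edge_sym y) => ->; rewrite orbT.
Qed.

Theorem theorem4p3 (G H : sgraph) :
  \max_(D : {bseq #|H| of H} | dominating_seq D)
     (grundy_total_dom G * num_nonadj_earlier D
      + (#|[set d in D]| - num_nonadj_earlier D) * grundy_dom G)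
  <= grundy_total_dom (strong_product G H).
Proof.
apply/bigmax_leqP=> D domD; rewrite card_dominating_seq //.
have [A lA szA] := max_legal_seqP (@open_nbhd G).
have [B lB szB] := max_legal_seqP (@closed_nbhd G).
have [S [lS _ szS]] := legal_open_strong _ _ _ lA lB domD.
by rewrite /grundy_total_dom /grundy_dom -szA -szB -szS size_legal_seq_le.
Qed.
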